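(* Consider a string $w$ of length $n$ and a context-free grammar $(V,\mathcal{R},\Sigma,T)$ in Chomsky normal form in which no two rules have the same right-hand side. Any computation (recomputation allowed) of the CYK algorithm deciding whether $w$ belongs to the language of the grammar, i.e. any schedule evaluating the CYK CDAG, on a machine with a cache of $M$ words and block size $B$, performs at least $$IO_{G_{CYK}}(n,M,B)\ \ge\ \max\left\{\frac{(n-6M-1)^3}{18\sqrt{M}}\Gamma-2M\Gamma,\ n\right\}\frac{1}{B}$$ I/O operations, where $\Gamma$ is the number of distinct right-hand sides of binary rules.
   Context: A grammar in Chomsky normal form has rules $A\to BC$ (binary rules, $B,C$ variables other than the start variable $T$), $A\to a$ ($a$ a terminal), or $T\to\epsilon$; $\mathcal{R}_B$ is the set of binary rules. CYK CDAG $G_{CYK}$: for each $1\le i\le j\le n$ and each variable $A$ there is a variable-root vertex $v^A_{i,j}$ (representing whether $A$ derives $w_i\cdots w_j$); the $v^A_{i,i}$ are inputs. For $i<j$, each $v^A_{i,j}$ is the root of a binary tree (edges towards the root) whose leaves are grammar-root vertices, one per binary rule with left-hand side $A$; the grammar-root vertex of $(i,j)$ for rule $A\to BC$ is the root of a binary tree (edges towards the root) with $j-i$ leaves indexed by $k\in\{i,\dots,j-1\}$, the leaf indexed $k$ having predecessors $v^B_{i,k}$ and $v^C_{k+1,j}$; all trees are vertex-disjoint. Memory model: cache of $M$ words and unbounded slow memory; each vertex value occupies one word; a vertex can be computed only when all its predecessors are in cache, the result being placed in cache; inputs are initially in slow memory; each read/write I/O operation moves up to $B$ consecutive words between slow memory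 and cache. $IO_{G_{CYK}}(n,M,B)$ is the minimum number of I/O operations over all schedules evaluating $G_{CYK}$. Standing assumption: $n$ and $M$ are powers of $2$, $n=2^a$, $M=2^b$ with $a,b\ge 3$.
   Formalization: For a variable A with no binary rule, the vertices v^A_{i,j} with i<j (whose tree would have no leaves) are taken as inputs initially in slow memory, like the v^A_{i,i}; if they could be computed for free the bound would fail (T→BC, B→b, C→c). *)

(* Defs.v *)
From HB Require Import structures.
From mathcomp Require Import all_boot all_order all_algebra finmap.

Set Implicit Arguments.
Unset Strict Implicit.
Unset Printing Implicit Defensive.

Local Open Scope fset_scope.

(* Context-free grammars (V, R, Sigma, T).  The rule list is only used through
   membership, so it stands for the finite set of its elements. *)
Record cfg := Cfg {
  var : finType;
  term : finType;
  start : var;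
  rules : seq (var * seq (var + term)) }.

Definition cnf_rule (G : cfg) (r : var G * seq (var G + term G)) : bool :=
  match r.2 with
  | [:: inl X; inl Y] => (X != start G) && (Y != start G)
  | [:: inr _] => true
  | [::] => r.1 == start G
  | _ => false
  end.

Definition chomsky_normal_form (G : cfg) : Prop :=
  forall r, r \in rules G -> cnf_rule r.

Definition distinct_rhs (G : cfg) : Prop :=
  forall r1 r2, r1 \in rules G -> r2 \in rules G -> r1.2 = r2.2 -> r1 = r2.

(* (A, (X, Y)) stands for the binary rule A -> X Y. *)
Definition brule (G : cfg) : Type := (var G * (var G * var G))%type.

Definition binary_rules (G : cfg) : {set var G * (var G * var G)} :=
  [set r | (r.1, [:: inl r.2.1; inl r.2.2]) \in rules G].

Definition rules_of (G : cfg) (A : var G) : {set var G * (var G * var G)} :=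
  [set r in binary_rules G | r.1 == A].

Definition Gamma (G : cfg) : nat :=
  #|[set r.2 | r in binary_rules G]|.

(* Inputs are the vertices without predecessors. *)
Record cdag := Cdag {
  vtx : choiceType;
  is_vtx : pred vtx;
  preds : vtx -> seq vtx }.

Definition is_input (D : cdag) (v : vtx D) : bool :=
  is_vtx v && nilp (preds v).

(* Only the identity of the vertex whose value a word holds is recorded. *)
Record state (D : cdag) := State {
  cache : {fset vtx D};
  slow : nat -> option (vtx D) }.

Inductive op (D : cdag) :=
  | Read of nat & nat             (* first address, number of words *)
  | Write of nat & seq (vtx D)    (* first address, values to be stored *)
  | Compute of vtx D
  | Evict of vtx D.

Arguments Read {D}.

Definition is_io (D : cdag) (o : op D) : bool :=
  match o with Read _ _ | Write _ _ => true | _ => false end.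

Definition io_count (D : cdag) (ops : seq (op D)) : nat := count (@is_io D) ops.

Definition enabled (D : cdag) (B : nat) (s : state D) (o : op D) : bool :=
  match o with
  | Read _ l => l <= B
  | Write _ vs => (size vs <= B) && all (fun v => v \in cache s) vs
  | Compute v => [&& is_vtx v, ~~ is_input v
                   & all (fun u => u \in cache s) (preds v)]
  | Evict _ => true
  end.

Definition next (D : cdag) (s : state D) (o : op D) : state D :=
  match o with
  | Read x l =>
      State (cache s `|` [fset v in pmap (slow s) (iota x l)]) (slow s)
  | Write x vs =>
      State (cache s) (fun y => if x <= y < x + size vs
                                then onth vs (y - x) else slow s y)
  | Compute v => State (v |` cache s) (slow s)
  | Evict v => State (cache s `\ v) (slow s)
  end.

Fixpoint legal (D : cdag) (M B : nat) (s : state D) (ops : seq (op D)) : bool :=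
  if ops is o :: ops' then
    [&& enabled B s o, #|` cache (next s o)| <= M & legal M B (next s o) ops']
  else true.

Definition initial (D : cdag) (s : state D) : Prop :=
  [/\ cache s = fset0,
      forall x v, slow s x = Some v -> is_input v
    & forall v, is_input v -> exists x, slow s x = Some v].

(* Every vertex holds its value in cache at some point: a non-input vertex by
   having been computed, an input by having been read. *)
Definition evaluates (D : cdag) (s : state D) (ops : seq (op D)) : Prop :=
  forall v, is_vtx v ->
    exists t, v \in cache (foldl (@next D) s (take t ops)).

Definition schedule (D : cdag) (M B : nat) (s : state D) (ops : seq (op D)) :
    Prop :=
  [/\ initial s, legal M B s ops & evaluates s ops].

(* Nonempty binary trees, with labelled leaves; a node has one or two
   children. *)
Inductive btree (X : Type) :=
  | Leaf of X
  | Node1 of btree X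
  | Node2 of btree X & btree X.

Arguments Node1 {X}.
Arguments Node2 {X}.

Fixpoint leaves (X : Type) (t : btree X) : seq X :=
  match t with
  | Leaf x => [:: x]
  | Node1 t1 => leaves t1
  | Node2 t1 t2 => leaves t1 ++ leaves t2
  end.

Fixpoint graft (X Y : Type) (f : X -> btree Y) (t : btree X) : btree Y :=
  match t with
  | Leaf x => f x
  | Node1 t1 => Node1 (graft f t1)
  | Node2 t1 t2 => Node2 (graft f t1) (graft f t2)
  end.

(* The subtree at a position; a position is the list of turns from the root. *)
Fixpoint subtree (X : Type) (t : btree X) (p : seq bool) {struct p} :
    option (btree X) :=
  match p, t with
  | [::], _ => Some t
  | false :: q, Node1 t1 => subtree t1 q
  | false :: q, Node2 t1 _ => subtree t1 q
  | true :: q, Node2 _ t2 => subtree t2 q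
  | _, _ => None
  end.

(* The binary trees of the CYK CDAG, whose shapes are left unspecified:
   vtree A i j joins the grammar roots of (i, j) into v^A_{i,j}, and gtree r i j
   joins the leaves k = i, ..., j - 1 into the grammar root of r at (i, j). *)
Record cyk_trees (G : cfg) (n : nat) := CykTrees {
  vtree : var G -> nat -> nat -> btree (brule G);
  gtree : brule G -> nat -> nat -> btree nat;
  leaves_vtree : forall A i j, 1 <= i -> i < j -> j <= n ->
    rules_of A != set0 -> perm_eq (leaves (vtree A i j)) (enum (rules_of A));
  leaves_gtree : forall r i j, 1 <= i -> i < j -> j <= n ->
    r \in binary_rules G -> perm_eq (leaves (gtree r i j)) (index_iota i j) }.

Section CYK.
Variables (G : cfg) (n : nat) (S : cyk_trees G n).

(* (A, i, j, p) is the vertex at position p of the tree rooted at v^A_{i,j};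
   this tree contains the trees of the grammar roots, grafted at the leaves of
   vtree A i j, and v^A_{i,j} itself is at position [::]. *)
Definition cyk_vtx : choiceType := (var G * nat * nat * seq bool)%type.

Definition cyk_root (A : var G) (i j : nat) : cyk_vtx := (A, i, j, [::]).

(* The leaf k of the tree of the grammar root of r is labelled (r, k). *)
Definition full_tree (A : var G) (i j : nat) : btree (brule G * nat) :=
  graft (fun r => graft (fun k => Leaf (r, k)) (gtree S r i j)) (vtree S A i j).

(* No tree is attached to v^A_{i,i}, nor to v^A_{i,j} when no binary rule has
   left-hand side A; these vertices have no predecessors. *)
Definition cyk_subtree (v : cyk_vtx) : option (btree (brule G * nat)) :=
  let: (A, i, j, p) := v in
  if (i < j) && (rules_of A != set0) then subtree (full_tree A i j) p else None.

Definition cyk_is_vtx (v : cyk_vtx) : bool :=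
  let: (A, i, j, p) := v in
  [&& 1 <= i, i <= j, j <= n & (p == [::]) || isSome (cyk_subtree v)].

Definition cyk_preds (v : cyk_vtx) : seq cyk_vtx :=
  let: (A, i, j, p) := v in
  match cyk_subtree v with
  | Some (Leaf ((_, (X, Y)), k)) => [:: cyk_root X i k; cyk_root Y k.+1 j]
  | Some (Node1 _) => [:: (A, i, j, rcons p false)]
  | Some (Node2 _ _) => [:: (A, i, j, rcons p false); (A, i, j, rcons p true)]
  | None => [::]
  end.

Definition cyk_cdag : cdag := Cdag cyk_is_vtx cyk_preds.

End CYK.

(* Main.v *)
Require Import Defs.
From HB Require Import structures.
From mathcomp Require Import all_boot all_order all_algebra finmap zify ring.
Import Order.TTheory GRing.Theory Num.Theory.
Local Open Scope ring_scope.

Set Implicit Arguments.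
Unset Strict Implicit.
Unset Printing Implicit Defensive.

(* Cut the schedule into phases moving 2M words each.  During a phase the
   vertices in cache derive from at most 3M sources (initial cache and loads),
   and together with what survives it (final cache and stores) this makes at
   most 4M vertices.

   Building v^A_{i,j} without any source inside its own tree takes at least
   j - i + 1 sources, so when j - i >= 3M a phase holding v^A_{i,j} has a source
   in its tree.  By the same token a phase that neither starts from nor hands
   over a vertex of the tree of a rule r at a long (i, j) cannot complete that
   tree, and its work there could be skipped; hence each leaf k of that tree has
   its two predecessors in cache during some phase having a source or a survivor
   in the tree of r at (i, j).  This holds with recomputation.

   Since right-hand sides are distinct, a Loomis-Whitney argument bounds the
   number of such leaves (r, i, k, j) per phase by sqrt (3M * 3M * 4M), provided
   that both factors have length at least 3M.  There are at least
   Gamma (n - 6M - 1)^3 / 6 leaves of this kind. *)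

(** * Pebble games *)

Section PebbleGame.
Local Open Scope fset_scope.
Local Open Scope nat_scope.
Variable D : cdag.
Local Notation V := (vtx D).

Inductive move := Fetch of V | Store of V | Calc of V | Drop of V.

Definition loads :=
  pmap (fun m => if m is Fetch v then Some v else None).
Definition stores :=
  pmap (fun m => if m is Store v then Some v else None).
Definition calcs :=
  pmap (fun m => if m is Calc v then Some v else None).

Definition is_transfer (m : move) : bool :=
  match m with Fetch _ | Store _ => true | _ => false end.

Definition red_next (R : {fset V}) (m : move) : {fset V} :=
  match m with
  | Fetch v | Calc v => v |` R
  | Store _ => R
  | Drop v => R `\ v
  end.

(** Blue values are never erased: overwriting in slow memory is ignored, which only admits more
    plays. *)
Definition blue_next (bl : V -> Prop) (m : move) : V -> Prop :=
  if m is Store v then fun u => u = v \/ bl u else bl.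

Definition allowed (R : {fset V}) (bl : V -> Prop) (m : move) : Prop :=
  match m with
  | Fetch v => bl v
  | Store v => v \in R
  | Calc v => [/\ is_vtx v, ~~ is_input v & {subset preds v <= R}]
  | Drop _ => True
  end.

Fixpoint play (M : nat) (R : {fset V}) (bl : V -> Prop) (ms : seq move) :
    Prop :=
  if ms is m :: ms' then
    [/\ allowed R bl m, #|` red_next R m| <= M
      & play M (red_next R m) (blue_next bl m) ms']
  else True.

Definition red_end := foldl red_next.
Definition blue_end := foldl blue_next.

Lemma play_cat M R bl ms1 ms2 :
  play M R bl (ms1 ++ ms2) <->
  play M R bl ms1 /\ play M (red_end R ms1) (blue_end bl ms1) ms2.
Proof.
elim: ms1 R bl => [|m ms1 IH] R bl /=; first by split=> [|[]].
by split=> [[am cm /IH [p1 p2]]|[[am cm p1] p2]]; do !split=> //; apply/IH.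
Qed.

Lemma size_loads_stores ms :
  size (loads ms) + size (stores ms) = count is_transfer ms.
Proof. by elim: ms => [|[] v ms IH] //=; lia. Qed.

Lemma red_end_le M R bl ms :
  #|` R| <= M -> play M R bl ms -> #|` red_end R ms| <= M.
Proof.
by elim: ms R bl => [|m ms IH] R bl //= cR [_ cm pl]; apply: IH cm pl.
Qed.

Lemma red_end_sub R ms v :
  v \in red_end R ms -> [|| v \in R, v \in loads ms | v \in calcs ms].
Proof.
elim: ms R => [|m ms IH] R /=; first by move=> ->.
move/IH; case: m => u /=; rewrite ?inE.
- by case: (v == u) => //=; rewrite ?orbT.
- by [].
- by case: (v == u) => //=; rewrite ?orbT.
- by case: (v == u) => //=; case: (v \in R).
Qed.

Lemma calcs_not_input M R bl ms v :
  play M R bl ms -> v \in calcs ms -> ~~ is_input v.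
Proof.
elim: ms R bl => [|m ms IH] R bl //= [am _ pl].
case: m am pl => u am pl; rewrite /= ?inE; try exact: (IH _ _ pl).
by case/predU1P=> [->|]; [case: am | exact: (IH _ _ pl)].
Qed.

(** * Translation of schedules into pebble games, one word per move *)

Definition moves_of (s : state D) (o : op D) : seq move :=
  match o with
  | Read x l => map Fetch (pmap (slow s) (iota x l))
  | Write _ vs => map Store vs
  | Compute v => [:: Calc v]
  | Evict v => [:: Drop v]
  end.

Lemma red_end_Fetch R vs : red_end R (map Fetch vs) = R `|` [fset v in vs].
Proof.
elim: vs R => [|v vs IH] R /=.
  by apply/fsetP=> u; rewrite !inE orbF.
by rewrite IH; apply/fsetP=> u; rewrite !inE orbCA orbA.
Qed.

Lemma red_end_Store R vs : red_end R (map Store vs) = R.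
Proof. by elim: vs R => [|v vs IH] R //=; rewrite IH. Qed.

Lemma blue_end_Fetch bl vs : blue_end bl (map Fetch vs) = bl.
Proof. by elim: vs bl => [|v vs IH] bl //=; rewrite IH. Qed.

Lemma blue_end_Store bl vs u :
  blue_end bl (map Store vs) u <-> u \in vs \/ bl u.
Proof.
elim: vs bl => [|v vs IH] bl /=; first by split=> [|[]]; [right | |].
have {}IH := IH (blue_next bl (Store v)); rewrite inE; split.
  by case/IH=> [->|[->|]]; [left; rewrite orbT | left; rewrite eqxx | right].
case=> [/predU1P [uv|uvs]|blu]; apply/IH; last by right; right.
  by right; left.
by left.
Qed.

Lemma red_end_moves_of s o :
  red_end (cache s) (moves_of s o) = cache (Defs.next s o).
Proof.
case: o => [x l|x vs|v|v] //=; first exact: red_end_Fetch.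
exact: red_end_Store.
Qed.

Lemma blue_end_moves_of s o (bl : V -> Prop) :
  (forall x v, slow s x = Some v -> bl v) ->
  forall x v, slow (Defs.next s o) x = Some v -> blue_end bl (moves_of s o) v.
Proof.
case: o => [x l|x vs|v|v] //= sbl y u.
  by rewrite blue_end_Fetch; apply: sbl.
case: ifP => [/andP [xy yx] E|_ /sbl blu]; apply/blue_end_Store; last by right.
by left; apply/onthP; exists (y - x).
Qed.

Lemma play_moves_of M B s o (bl : V -> Prop) :
  (forall x v, slow s x = Some v -> bl v) ->
  enabled B s o -> #|` cache (Defs.next s o)| <= M ->
  play M (cache s) bl (moves_of s o).
Proof.
case: o => [x l|x vs|v|v] /= sbl.
- move=> _; have: all (fun v => v \in pmap (slow s) (iota x l))
                      (pmap (slow s) (iota x l)) by apply/allP.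
  have {sbl}: forall v, v \in pmap (slow s) (iota x l) -> bl v.
    by move=> v; rewrite mem_pmap => /mapP [y _ /esym /sbl].
  move: (pmap _ _) => vs0 blvs.
  move: {-1}vs0 => vs; elim: vs (cache s) => [|v vs IH] R //= /andP [vvs avs] c.
  split; first exact: blvs.
    (* Halfway through a read the cache is contained in the final one, which fits. *)
    apply: leq_trans c; apply/fsubset_leq_card/fsubsetP => u; rewrite !inE.
    by case/orP=> ->; rewrite ?orbT.
  apply: IH => //; apply: leq_trans c.
  rewrite leq_eqVlt; apply/orP; left; apply/eqP; congr (#|` _|).
  by apply/fsetP=> u; rewrite !inE orbCA orbA.
- case/andP=> _; elim: vs bl {sbl} => [|v vs IH] bl //= /andP [vc avs] c.
  by split=> //; apply: IH.
- by case/and3P=> vv nv /allP pv c; split.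
- by move=> _ c; split.
Qed.

Lemma count_moves_of B s o :
  enabled B s o -> count is_transfer (moves_of s o) <= B * is_io o.
Proof.
case: o => [x l|x vs|v|v] //=; rewrite ?muln1.
  move=> lB; apply: leq_trans (count_size _ _) _.
  rewrite size_map size_pmap; apply: leq_trans (count_size _ _) _.
  by rewrite size_iota.
by case/andP=> sB _; apply: leq_trans (count_size _ _) _; rewrite size_map.
Qed.

Fixpoint moves (s : state D) (ops : seq (op D)) : seq move :=
  if ops is o :: ops' then moves_of s o ++ moves (Defs.next s o) ops' else [::].

Lemma play_moves M B s ops (bl : V -> Prop) :
  (forall x v, slow s x = Some v -> bl v) ->
  legal M B s ops -> play M (cache s) bl (moves s ops).
Proof.
elim: ops s bl => [|o ops IH] s bl sbl //= /and3P [en c lg].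
apply/play_cat; split; first exact: play_moves_of en c.
by rewrite red_end_moves_of; apply: IH lg; apply: blue_end_moves_of.
Qed.

Lemma count_moves M B s ops :
  legal M B s ops -> count is_transfer (moves s ops) <= B * io_count ops.
Proof.
rewrite /io_count; elim: ops s => [|o ops IH] s //= /and3P [en _ lg].
by rewrite count_cat mulnDr leq_add ?count_moves_of ?IH.
Qed.

Lemma cache_moves s ops t v :
  v \in cache (foldl (@Defs.next D) s (take t ops)) ->
  [|| v \in cache s, v \in loads (moves s ops) | v \in calcs (moves s ops)].
Proof.
elim: ops s t => [|o ops IH] s [|t] //= ; try by move=> ->.
move/IH; rewrite -red_end_moves_of /loads /calcs !pmap_cat !mem_cat.
case/or3P=> [/red_end_sub /or3P [] ->|->|->]; rewrite ?orbT //.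
Qed.

(* The data recorded for a phase are the vertices it can start from (initial
   cache and loads), those that survive it (final cache and stores), and those
   which are in cache at some time during it. *)
Definition phase : Type := (seq V * seq V * seq V)%type.
Definition sources (ph : phase) := ph.1.1.
Definition targets (ph : phase) := ph.1.2.
Definition touched (ph : phase) := ph.2.

Definition phase_of (R : {fset V}) (ms : seq move) : phase :=
  (enum_fset R ++ loads ms, enum_fset (red_end R ms) ++ stores ms,
   enum_fset R ++ loads ms ++ calcs ms).

Fixpoint phases (R : {fset V}) (segs : seq (seq move)) : seq phase :=
  if segs is ms :: segs' then phase_of R ms :: phases (red_end R ms) segs'
  else [::].

Lemma size_phases R segs : size (phases R segs) = size segs.
Proof. by elim: segs R => [|ms segs IH] R //=; rewrite IH. Qed.

Lemma phases_ind (P : phase -> Prop) M K R bl segs :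
  #|` R| <= M -> play M R bl (flatten segs) ->
  all (fun ms => count is_transfer ms <= K) segs ->
  (forall R' bl' ms, #|` R'| <= M -> play M R' bl' ms ->
     count is_transfer ms <= K -> P (phase_of R' ms)) ->
  forall ph, ph \in phases R segs -> P ph.
Proof.
move=> cR pl aK HP; elim: segs R bl cR pl aK => [|ms segs IH] R bl cR //=.
move=> /play_cat [p1 p2] /andP [k1 k2] ph; rewrite inE => /predU1P [->|].
  exact: HP p1 k1.
by apply: (IH _ _ _ p2 k2); apply: red_end_le p1.
Qed.

Lemma size_sources M K R ms :
  #|` R| <= M -> count is_transfer ms <= K ->
  size (sources (phase_of R ms)) <= M + K.
Proof.
move=> cR; rewrite -size_loads_stores /sources /= size_cat => lK.
by apply: leq_add => //; apply: leq_trans (leq_addr _ _) lK.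
Qed.

(** Both caches contribute [M], but loads and stores share the same [K] transfers. *)
Lemma size_sources_targets M K R bl ms :
  #|` R| <= M -> play M R bl ms -> count is_transfer ms <= K ->
  size (sources (phase_of R ms) ++ targets (phase_of R ms)) <= M.*2 + K.
Proof.
move=> cR pl; rewrite -size_loads_stores /sources /targets /= !size_cat.
have := red_end_le cR pl; move: cR.
move: (size (enum_fset R)) (size (enum_fset _)) => x y; lia.
Qed.

(** All that is kept of the order of computation. The condition [preds u <> [::]] makes every
    touched input a source. *)
Definition phase_closed (ph : phase) : Prop :=
  forall u, u \in touched ph ->
    u \in sources ph \/ preds u <> [::] /\ {subset preds u <= touched ph}.

Lemma phase_of_closed M R bl ms :
  play M R bl ms -> phase_closed (phase_of R ms).
Proof.
move=> pl u; rewrite /touched /sources /= catA mem_cat.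
case/orP=> [|uc]; first by left.
right; set T := _ ++ calcs ms.
have: {subset R <= T} by move=> v vR; rewrite !mem_cat vR.
have: {subset loads ms <= T} by move=> v vR; rewrite !mem_cat vR orbT.
have: {subset calcs ms <= T} by move=> v vR; rewrite !mem_cat vR !orbT.
(* The target set stays fixed while the induction consumes the play. *)
move: (T) => T'; elim: ms R bl pl uc {T} => [|m ms IH] R bl //=.
case: m => v [av _ pl] uc sc sl sR; try (apply: (IH _ _ pl uc) => //).
- by move=> w wl; apply: sl; rewrite /= inE wl orbT.
- move=> w /=; rewrite !inE => /predU1P [->|]; last exact: sR.
  by apply: sl; rewrite /= mem_head.
- move: uc; rewrite /= inE => /predU1P [->|uc].
    case: av => vv nv pv; split; last by move=> w /pv /sR.
    by move=> E; move: nv; rewrite /is_input vv E.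
  apply: (IH _ _ pl uc) => // [w wl|w].
    by apply: sc; rewrite /= inE wl orbT.
  rewrite /= !inE => /predU1P [->|]; last exact: sR.
  by apply: sc; rewrite /= mem_head.
- by move=> w; rewrite !inE => /andP [_ /sR].
Qed.

Lemma touched_phases R segs v :
  v \in loads (flatten segs) ++ calcs (flatten segs) ->
  exists2 ph, ph \in phases R segs & v \in touched ph.
Proof.
elim: segs R => [|ms segs IH] R //=.
rewrite /loads /calcs !pmap_cat -/loads -/calcs => vs.
case: (boolP (v \in touched (phase_of R ms))) => [vt|].
  by exists (phase_of R ms); rewrite ?mem_head.
rewrite /touched /= !mem_cat !negb_or => /and3P [_ nl nc].
have [|ph phP vph] := IH (red_end R ms).
  by move: vs; rewrite !mem_cat (negPf nl) (negPf nc).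
by exists ph; rewrite // inE phP orbT.
Qed.

(* A phase that no vertex of [U] enters or leaves cannot contribute to what is
   later known of [U]: its work inside [U] could be skipped. *)
Section Isolation.
Variables (U : pred V) (fine : V -> Prop).

Definition isolated (ph : phase) : bool := ~~ has U (sources ph ++ targets ph).

Definition fine_preserved (T : seq V) : Prop :=
  forall u, U u -> preds u <> [::] ->
    (forall v, v \in preds u -> v \in T /\ (U v -> fine v)) -> fine u.

Let settled (R : {fset V}) (bl : V -> Prop) : Prop :=
  forall u, U u -> u \in R \/ bl u -> fine u.

Lemma settled_play M R bl ms T :
  play M R bl ms -> {subset R <= T} -> {subset loads ms <= T} ->
  {subset calcs ms <= T} -> fine_preserved T -> settled R bl ->
  settled (red_end R ms) (blue_end bl ms) /\
  (forall u, u \in loads ms ++ calcs ms -> U u -> fine u).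
Proof.
move=> pl sR sl sc fp; elim: ms R bl pl sR sl sc => [|m ms IH] R bl //=.
have add R' v : {subset R' <= T} -> v \in T -> {subset v |` R' <= T}.
  by move=> sR vT w; rewrite !inE => /predU1P [->|/sR].
have tl s v : {subset v :: s <= T} -> v \in T /\ {subset s <= T}.
  move=> H; split=> [|w ws]; first by apply: H; rewrite mem_head.
  by apply: H; rewrite inE ws orbT.
have stadd v : settled R bl -> (U v -> fine v) -> settled (v |` R) bl.
  move=> st fv u Uu; rewrite !inE => -[/predU1P [uv|uR]|blu].
  - by move: Uu; rewrite uv.
  - by apply: st Uu _; left.
  - by apply: st Uu _; right.
case: m => v [av _ pl] sR.
- move=> /tl [vT sl] sc st; have fv : U v -> fine v by move/st; apply; right.
  have [st' fl] := IH _ _ pl (add _ _ sR vT) sl sc (stadd v st fv).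
  by split=> // u; rewrite /= inE => /predU1P [->|/fl].
- move=> sl sc st; apply: (IH _ _ pl sR sl sc) => u Uu [uR|[uv|blu]].
  + by apply: st Uu _; left.
  + by apply: st Uu _; left; rewrite uv.
  + by apply: st Uu _; right.
- move=> sl /tl [vT sc] st; case: av => vv nv pv.
  have fv : U v -> fine v.
    move=> Uv; apply: (fp _ Uv) => [E|w /pv wR].
      by move: nv; rewrite /is_input vv E.
    by split=> [|Uw]; [exact: sR | apply: st Uw _; left].
  have [st' fl] := IH _ _ pl (add _ _ sR vT) sl sc (stadd v st fv).
  split=> // u; rewrite mem_cat /= inE orbCA => /predU1P [->|ul] //.
  by apply: fl; rewrite mem_cat.
- move=> sl sc st; apply: (IH _ _ pl _ sl sc) => [w|u Uu].
    by rewrite !inE => /andP [_ /sR].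
  by rewrite !inE => -[/andP [_ uR]|blu]; apply: st Uu _; [left | right].
Qed.

Lemma blue_end_sub bl ms u : blue_end bl ms u -> u \in stores ms \/ bl u.
Proof.
elim: ms bl => [|m ms IH] bl /=; first by right.
move/IH; case: m => v //= -[|[]]; rewrite ?inE.
- by move=> ->; left; rewrite orbT.
- by move=> ->; left; rewrite eqxx.
- by right.
Qed.

(** Induction over the phases with invariant [settled]. An isolated phase may touch vertices of [U]
    that are not fine, but none is in its final cache or stores, so the invariant survives; in the
    other phases [settled_play] applies. *)
Lemma fine_touched M R bl segs :
  play M R bl (flatten segs) -> settled R bl ->
  (forall ph, ph \in phases R segs -> ~~ isolated ph ->
     fine_preserved (touched ph)) ->
  forall ph, ph \in phases R segs -> ~~ isolated ph ->
  forall u, u \in touched ph -> U u -> fine u.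
Proof.
elim: segs R bl => [|ms segs IH] R bl //= /play_cat [pl pls] st fp.
have [iso|niso] := boolP (isolated (phase_of R ms)).
  move=> ph; rewrite inE => /predU1P [->|phs]; first by rewrite iso.
  apply: (IH _ _ pls) phs => [u Uu H|ph' ph's].
    have: u \notin targets (phase_of R ms).
      apply: contraL iso => ut; rewrite negbK; apply/hasP.
      by exists u; rewrite // mem_cat ut orbT.
    rewrite mem_cat negb_or => /andP [nr ns].
    case: H => [ur|/blue_end_sub [us|blu]]; first by rewrite ur in nr.
      by rewrite us in ns.
    by apply: st Uu _; right.
  by apply: fp; rewrite inE ph's orbT.
have fp0 := fp _ (mem_head _ _) niso.
have [|||st' fl] := settled_play pl _ _ _ fp0 st.
- by move=> v vR; rewrite mem_cat vR.
- by move=> v vR; rewrite !mem_cat vR orbT.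
- by move=> v vR; rewrite !mem_cat vR !orbT.
move=> ph; rewrite inE => /predU1P [-> _ u|phs].
  rewrite mem_cat => /orP [uR Uu|]; last exact: fl.
  by apply: st Uu _; left.
apply: (IH _ _ pls) phs => // ph' ph's.
by apply: fp; rewrite inE ph's orbT.
Qed.

End Isolation.
End PebbleGame.

(** Segments are filled greedily from the end of the list, and one is closed only when full. Hence
    all but the first have weight exactly [K], which is why [ms0] is kept apart. *)
Lemma split_phases (T : Type) (w : pred T) (K : nat) (ms : seq T) :
  (0 < K)%N ->
  exists ms0 segs,
    [/\ flatten (ms0 :: segs) = ms,
        all (fun ms' => count w ms' <= K)%N (ms0 :: segs)
      & (K * size segs + count w ms0 <= count w ms)%N].
Proof.
move=> K0; elim: ms => [|m ms [ms0 [segs [<- /= /andP [k0 ks] H]]]].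
  by exists [::], [::]; split; rewrite //= muln0.
have [k1|k1] := leqP (w m + count w ms0) K.
  by exists (m :: ms0), segs; split; rewrite //= ?k1 //; lia.
exists [:: m], (ms0 :: segs); split; rewrite //= ?k0 ?ks ?andbT; last lia.
by case: (w m); lia.
Qed.

(** * The CYK CDAG *)

Section Trees.
Local Open Scope nat_scope.

Lemma subtree_cat (X : Type) (t : btree X) p q :
  subtree t (p ++ q) = obind (fun t' => subtree t' q) (subtree t p).
Proof. by elim: p t => [|[] p IH] [x|t1|t1 t2] //=. Qed.

Lemma subtree_graft (X Y : Type) (f : X -> btree Y) t p t' :
  subtree t p = Some t' -> subtree (graft f t) p = Some (graft f t').
Proof.
elim: p t => [|[] p IH] [x|t1|t1 t2] //=; try exact: IH; by move=> [<-].
Qed.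

Lemma subtree_leaf (X : eqType) (t : btree X) x :
  x \in leaves t -> exists p, subtree t p = Some (Leaf x).
Proof.
elim: t => [y|t1 IH|t1 IH1 t2 IH2] /=.
- by rewrite inE => /eqP ->; exists [::].
- by case/IH=> p E; exists (false :: p).
- rewrite mem_cat => /orP [/IH1|/IH2] [p E].
    by exists (false :: p).
  by exists (true :: p).
Qed.

Lemma leaves_graft (X Y : Type) (f : X -> btree Y) t :
  leaves (graft f t) = flatten [seq leaves (f x) | x <- leaves t].
Proof.
by elim: t => [x|t1 IH|t1 IH1 t2 IH2] //=; rewrite ?cats0 // map_cat
   flatten_cat IH1 IH2.
Qed.

Lemma leaves_relabel (X Y : Type) (f : X -> Y) t :
  leaves (graft (fun x => Leaf (f x)) t) = [seq f x | x <- leaves t].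
Proof. by rewrite leaves_graft; elim: (leaves t) => [|x s /= ->]. Qed.

Lemma leaves_neq0 (X : Type) (t : btree X) : leaves t <> [::].
Proof. by elim: t => [x|t1 IH|t1 IH1 t2 IH2] //=; case: (leaves t1) IH1. Qed.

Lemma leaves_subtree (X : eqType) (t : btree X) p t' :
  subtree t p = Some t' -> {subset leaves t' <= leaves t}.
Proof.
elim: p t => [|[] p IH] [x|t1|t1 t2] //=; try by move=> [<-].
- by move=> /IH H x /H; rewrite mem_cat => ->; rewrite orbT.
- exact: IH.
- by move=> /IH H x /H; rewrite mem_cat => ->.
Qed.

End Trees.

(** * Number of sources a phase needs in order to build a root *)

Section CykPhase.
Local Open Scope nat_scope.
Variables (G : cfg) (n : nat) (S : cyk_trees G n).
Local Notation D := (cyk_cdag S).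
Local Notation root A i j := (cyk_root A i j : vtx D).

Definition labels (v : cyk_vtx G) : seq (brule G * nat) :=
  if cyk_subtree S v is Some t then leaves t else [::].

Lemma cyk_subtree_cat A i j p q :
  cyk_subtree S (A, i, j, p ++ q) =
  obind (fun t => subtree t q) (cyk_subtree S (A, i, j, p)).
Proof. by rewrite /cyk_subtree; case: ifP => // _; rewrite subtree_cat. Qed.

Lemma cyk_subtree_rcons A i j p b t :
  cyk_subtree S (A, i, j, p) = Some t ->
  cyk_subtree S (A, i, j, rcons p b) = subtree t [:: b].
Proof. by move=> E; rewrite -cats1 cyk_subtree_cat E. Qed.

Lemma cyk_predsE A i j p :
  @preds D (A, i, j, p) =
  match cyk_subtree S (A, i, j, p) with
  | Some (Leaf ((_, (X, Y)), k)) => [:: cyk_root X i k; cyk_root Y k.+1 j]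
  | Some (Node1 _) => [:: (A, i, j, rcons p false)]
  | Some (Node2 _ _) => [:: (A, i, j, rcons p false); (A, i, j, rcons p true)]
  | None => [::]
  end.
Proof. by []. Qed.

Lemma labels_subtree A i j p q :
  {subset labels (A, i, j, p ++ q) <= labels (A, i, j, p)}.
Proof.
move=> x; rewrite /labels cyk_subtree_cat.
case: (cyk_subtree S (A, i, j, p)) => [t|] //=.
by case E: subtree => [t'|] //; apply: leaves_subtree E x.
Qed.

(** One step down the tree towards the leaf [(r, k)]: either [u] is that leaf, or a child of [u]
    still lies above it. *)
Lemma labels_preds (u : vtx D) r k :
  (r, k) \in labels u ->
  (root r.2.1 u.1.1.2 k \in preds u /\ root r.2.2 k.+1 u.1.2 \in preds u)
  \/ exists v, [/\ v \in preds u, v.1 = u.1, (r, k) \in labels v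
                  & {subset labels v <= labels u}].
Proof.
case: u => [[[A i] j] p] rk.
have sub b : {subset labels (A, i, j, rcons p b) <= labels (A, i, j, p)}.
  by rewrite -cats1; apply: labels_subtree.
move: rk; rewrite {1}/labels cyk_predsE; case E: cyk_subtree => [t|] //.
have Eb b : labels (A, i, j, rcons p b) =
            if subtree t [:: b] is Some t' then leaves t' else [::].
  by rewrite /labels (cyk_subtree_rcons _ E).
case: t E Eb => [[[A' [X Y]] k']|t1|t1 t2] E Eb.
- by rewrite inE => /eqP [-> ->] /=; left; rewrite !inE !eqxx orbT.
- move=> rk; right; exists (A, i, j, rcons p false).
  by rewrite mem_head; split=> //; first by rewrite Eb.
- rewrite mem_cat => /orP [rk|rk]; right.
    exists (A, i, j, rcons p false); rewrite mem_head.
    by split=> //; rewrite Eb.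
  exists (A, i, j, rcons p true); rewrite !inE eqxx orbT.
  by split=> //; rewrite Eb.
Qed.

Lemma preds_neq0 (u : vtx D) : labels u != [::] -> preds u <> [::].
Proof.
case: u => [[[A i] j] p]; rewrite /labels cyk_predsE.
by case: cyk_subtree => [[[[? [? ?]] ?]|?|? ?]|].
Qed.

(** The vertex is the grammar root of [r]: [p] is the position of the leaf [r] in [vtree], where
    [gtree] is grafted. *)
Lemma labels_grammar_root r i j :
  0 < i -> i < j -> j <= n -> r \in binary_rules G ->
  exists2 p, is_vtx ((r.1, i, j, p) : vtx D) &
    labels (r.1, i, j, p) =i [seq (r, k) | k <- index_iota i j].
Proof.
move=> i0 ij jn rb; have rA : r \in rules_of r.1 by rewrite inE rb eqxx.
have ne : rules_of r.1 != set0 by apply/set0Pn; exists r.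
have rl : r \in leaves (vtree S r.1 i j).
  by rewrite (perm_mem (leaves_vtree S i0 ij jn ne)) mem_enum.
have [p Ep] := subtree_leaf rl.
have E : cyk_subtree S (r.1, i, j, p) =
         Some (graft (fun k => Leaf (r, k)) (gtree S r i j)).
  by rewrite /cyk_subtree ij ne /= /full_tree (subtree_graft _ Ep).
exists p.
  by rewrite /is_vtx /cyk_cdag /cyk_is_vtx E i0 (ltnW ij) jn orbT.
move=> x; rewrite /labels E leaves_relabel.
exact/eq_mem_map/perm_mem/leaves_gtree.
Qed.

Lemma labels_root A i j r k :
  0 < i -> i < j -> j <= n -> rules_of A != set0 ->
  r \in rules_of A -> i <= k < j -> (r, k) \in labels (A, i, j, [::]).
Proof.
move=> i0 ij jn ne; rewrite inE => /andP [rb /eqP rA] kij.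
have [p _ H] := labels_grammar_root i0 ij jn rb.
apply: (@labels_subtree A i j [::] p); rewrite -rA H /=.
by apply/mapP; exists k; rewrite ?mem_index_iota.
Qed.

Variable ph : phase D.
Hypothesis ph_closed : phase_closed ph.

(** With no source at or below [p], the phase has to build the whole subtree, so the descent reaches
    every leaf and its two predecessors. *)
Lemma labels_touched A i j p r k :
  (A, i, j, p) \in touched ph ->
  (forall q, labels (A, i, j, p ++ q) != [::] ->
     (A, i, j, p ++ q) \notin sources ph) ->
  (r, k) \in labels (A, i, j, p) ->
  root r.2.1 i k \in touched ph /\ root r.2.2 k.+1 j \in touched ph.
Proof.
move=> pt ns; rewrite /labels; case E: cyk_subtree => [t|] //.
elim: t p E pt ns => [[[A' [X Y]] k']|t1 IH|t1 IH1 t2 IH2] p E pt ns.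
all: have E' := cyk_subtree_rcons _ E.
all: have /ph_closed [ps|[_ pp]] := pt;
  first by case: (negP (ns [::] _)); rewrite cats0 // /labels E;
           apply/eqP/leaves_neq0.
all: move: pp; rewrite cyk_predsE E => pp.
- rewrite inE => /eqP [-> ->] /=.
  by split; apply: pp; rewrite !inE eqxx ?orbT.
- apply: (IH _ (E' false)); first by apply: pp; rewrite mem_head.
  by move=> q; rewrite cat_rcons; apply: ns.
- rewrite mem_cat.
  case/orP; [apply: (IH1 _ (E' false)) | apply: (IH2 _ (E' true))].
  + by apply: pp; rewrite mem_head.
  + by move=> q; rewrite cat_rcons; apply: ns.
  + by apply: pp; rewrite !inE eqxx orbT.
  + by move=> q; rewrite cat_rcons; apply: ns.
Qed.

Definition inner i j := count (fun u : vtx D => (i <= u.1.1.2) && (u.1.2 <= j))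
                              (sources ph).

Lemma inner_lt i j (u : vtx D) :
  u \in sources ph -> u.1.1.2 = i -> u.1.2 <= j -> inner i.+1 j < inner i j.
Proof.
rewrite /inner => us ui uj; elim: (sources ph) us => [|v s IH] //=.
have le_s : count (fun u : vtx D => (i < u.1.1.2) && (u.1.2 <= j)) s <=
            count (fun u : vtx D => (i <= u.1.1.2) && (u.1.2 <= j)) s.
  by apply: sub_count => w /andP [/ltnW -> ->].
have le_v : (i < v.1.1.2) && (v.1.2 <= j) <= (i <= v.1.1.2) && (v.1.2 <= j).
  by case: (ltnP i v.1.1.2) => // /ltnW ->.
rewrite inE => /predU1P [uv|/IH lt_s]; last by rewrite -addnS leq_add.
by rewrite -uv ui uj ltnn leqnn ltnS.
Qed.

Lemma root_input_source A i :
  root A i i \in touched ph -> root A i i \in sources ph.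
Proof.
case/ph_closed=> // -[]; by rewrite cyk_predsE /= ltnn.
Qed.

(* Every split point of [i, j] has to be accounted for: going from the right
   end to the left, each right factor either is available as such, or was
   itself built from sufficiently many sources. *)
Lemma inner_split X Y i j :
  i < j -> root X i i \in touched ph ->
  (forall k, i < k <= j -> root Y k j \in touched ph) ->
  (forall k, i < k <= j -> root Y k j \in touched ph ->
     (exists p, (Y, k, j, p) \in sources ph) \/ j - k < inner k j) ->
  j - i < inner i j.
Proof.
move=> ij Xi Yk IH.
have H l : l < j - i -> l < inner (j - l) j.
  elim: l => [|l IHl] lt_l.
    rewrite subn0.
    apply: leq_ltn_trans (inner_lt (u := root Y j j) _ _ _) => //.
    by apply/root_input_source/Yk; lia.
  have ? : i < j - l.+1 <= j by lia.
  (* A source in the tree of [Y] at [(j - l.+1, j)] has a new left end, so it adds one to those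
     already counted. *)
  have [//||[p ps]|] := IH (j - l.+1); first exact: Yk.
    have := inner_lt (u := (Y, j - l.+1, j, p)) ps erefl (leqnn _).
    rewrite /= (_ : (j - l.+1).+1 = j - l); last by lia.
    by apply: leq_ltn_trans; apply: IHl; lia.
  by apply: leq_trans; lia.
(* The right factors yield [j - i] sources with left end beyond [i]; the input at [(i, i)] is one
   more. *)
have := H (j - i).-1; have -> : j - (j - i).-1 = i.+1 by lia.
move=> Hi; have {}Hi : (j - i).-1 < inner i.+1 j by apply: Hi; lia.
have := inner_lt (i := i) (root_input_source Xi) erefl (ltnW ij).
by lia.
Qed.

(** Strong induction on [j - i]. Without a source in its own tree, the root was built in full; any
    single rule of [A] then supplies all split points to [inner_split], whose right factors are
    shorter. *)
Lemma root_touched A i j :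
  0 < i -> i <= j -> j <= n -> root A i j \in touched ph ->
  (exists p, (A, i, j, p) \in sources ph) \/ j - i < inner i j.
Proof.
move: {-1}(j - i) (erefl (j - i)) => l; elim/ltn_ind: l A i j.
move=> l IH A i j El i0 ij jn rt.
case: (boolP (has (fun u : vtx D => u.1 == (A, i, j)) (sources ph))).
  by case/hasP=> -[v p] us /= /eqP E; left; exists p; rewrite -E.
move=> /hasPn ns; right.
have ns' p : (A, i, j, p) \notin sources ph.
  by apply/negP=> /ns /=; rewrite eqxx.
have [rs|[np _]] := ph_closed rt; first by move: (ns' [::]); rewrite rs.
have [lt_ij ne] : i < j /\ rules_of A != set0.
  by move: np; rewrite cyk_predsE /=; case: ifP => // /andP [].
have /set0Pn [r rA] := ne.
have H k : i <= k < j ->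
    root r.2.1 i k \in touched ph /\ root r.2.2 k.+1 j \in touched ph.
  move=> kij; apply: (labels_touched rt); first by move=> q _; apply: ns'.
  exact: labels_root.
rewrite -El; apply: (@inner_split r.2.1 r.2.2) => //.
- by case: (H i) => //; lia.
- by move=> [|k] kij //; case: (H k) => //; lia.
- by move=> k kij; apply: (IH (j - k)); lia.
Qed.

End CykPhase.

(** * Counting *)

Section Counting.
Local Open Scope nat_scope.

(** Cauchy-Schwarz against the constant sequence 1. *)
Lemma sqr_sum_le (I : Type) (s : seq I) (F : I -> nat) :
  (\sum_(i <- s) F i) ^ 2 <= size s * \sum_(i <- s) F i ^ 2.
Proof.
elim: s => [|a s IH]; first by rewrite !big_nil.
rewrite !big_cons /=.
have : 2 * (F a * \sum_(i <- s) F i) <=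
       size s * F a ^ 2 + \sum_(i <- s) F i ^ 2.
  elim: s {IH} => [|b s IH]; first by rewrite !big_nil muln0.
  have [C _] := nat_Cauchy (F a) (F b).
  rewrite !big_cons /= 2!mulnDr mulSn; move: (F a ^ 2) (F b ^ 2) C IH; lia.
rewrite sqrnD mulSn mulnDr; move: (F a ^ 2) (_ ^ 2) IH; lia.
Qed.

Lemma sum_card_fibers (T : finType) (I : eqType) (h : T -> I) (A : {set T})
    (s : seq I) :
  uniq s -> (forall x, x \in A -> h x \in s) ->
  \sum_(q <- s) #|[set x in A | h x == q]| = #|A|.
Proof.
move=> us hs.
under eq_bigr => q _ do rewrite -sum1_card.
rewrite -[RHS]sum1_card (exchange_big_dep (mem A)) /=; last first.
  by move=> q x _; rewrite inE => /andP [].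
apply: eq_bigr => x xA.
under eq_bigl => q do rewrite inE xA eq_sym.
by rewrite sum1_count count_uniq_mem // hs.
Qed.

(* A discrete Loomis-Whitney inequality: two elements with the same third
   projection are recovered from the first projection of the one and the second
   projection of the other. *)
Lemma card_le_projections (T : finType) (A1 A2 A3 : eqType) (f : T -> A1)
    (g : T -> A2) (h : T -> A3) (N : {set T}) (P1 : seq A1) (P2 : seq A2)
    (Q : seq A3) :
  (forall x, x \in N -> [/\ f x \in P1, g x \in P2 & h x \in Q]) ->
  {in N &, forall x y, {in N &, forall x' y', h x = h y -> h x' = h y' ->
     f x = f x' -> g y = g y' -> (x, y) = (x', y')}} ->
  #|N| ^ 2 <= size P1 * size P2 * size Q.
Proof.
move=> NP inj.
have hQ x : x \in N -> h x \in undup Q by rewrite mem_undup => /NP [].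
rewrite -(sum_card_fibers (undup_uniq Q) hQ).
apply: leq_trans (sqr_sum_le _ _) _; rewrite mulnC leq_mul ?size_undup //.
(* Pairs within a fibre of [h]: their number is the sum of the squared fibre sizes, and [(f x, g y)]
   embeds them into [P1] times [P2]. *)
pose W := [set z in setX N N | h z.1 == h z.2].
have WN z : z \in W -> [/\ z.1 \in N, z.2 \in N & h z.1 = h z.2].
  by rewrite !inE => /andP [/andP [-> ->] /eqP ->].
have -> : \sum_(q <- undup Q) #|[set x in N | h x == q]| ^ 2 = #|W|.
  rewrite -(@sum_card_fibers _ _ (fun z => h z.1) W _ (undup_uniq Q)).
    apply: eq_bigr => q _; rewrite -mulnn -cardsX; apply: eq_card => -[x y].
    rewrite !inE /=; case: (x \in N) (y \in N) => [] [] //=; rewrite ?andbF //.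
    by have [->|] := eqVneq (h x) q; rewrite ?andbF //= andbT eq_sym.
  by move=> z /WN [/hQ].
rewrite cardE -(size_map (fun z => (f z.1, g z.2))) -(size_allpairs pair).
apply: uniq_leq_size.
  rewrite map_inj_in_uniq ?enum_uniq // => -[x y] [x' y'].
  rewrite !mem_enum => /WN /= [xN yN hxy] /WN /= [x'N y'N hxy'] [fx gy].
  exact: inj.
move=> _ /mapP [[x y] xyW ->]; rewrite mem_enum in xyW.
have [/= xN yN _] := WN _ xyW.
have [fx _ _] := NP _ xN; have [_ gy _] := NP _ yN.
exact: allpairs_f.
Qed.

Lemma card_cover_le (T : finType) (I : eqType) (A : {set T}) (s : seq I)
    (N : I -> {set T}) :
  (forall x, x \in A -> exists2 q, q \in s & x \in N q) ->
  #|A| <= \sum_(q <- s) #|N q|.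
Proof.
elim: s A => [|q s IH] A AN.
  by rewrite big_nil leqn0 cards_eq0 -subset0; apply/subsetP=> x /AN [].
rewrite big_cons -(cardsID (N q) A) leq_add ?subset_leq_card ?subsetIr //.
apply: IH => x; rewrite inE => /andP [xq /AN [q']].
by rewrite inE => /predU1P [->|q's xq']; [rewrite (negPf xq) | exists q'].
Qed.

(** Triples [(i, k, j)]; the last inequality is strict because the right factor starts at
    [k + 1]. *)
Definition far_triples (n d : nat) : {set 'I_n.+1 * 'I_n.+1 * 'I_n.+1} :=
  [set t : 'I_n.+1 * 'I_n.+1 * 'I_n.+1 |
    [&& 0 < t.1.1, t.1.1 + d <= t.1.2 & t.1.2 + d < t.2]].

Lemma card_far_triples n d :
  (n - d.*2 - 1) ^ 3 <= 6 * #|far_triples n d|.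
Proof.
case Em: (n - d.*2 - 1) => [|m] //.
(* Nondecreasing triples in [0..m] number ['C(m + 3, 3)], at least [(m + 1) ^ 3 / 6]. The shifts in
   [F] create the gaps; the largest value reached is [m + 2 + d.*2 = n]. *)
pose st := [set t : 3.-tuple 'I_m.+1 | sorted leq [seq val x | x <- t]].
pose F (t : 3.-tuple 'I_m.+1) : 'I_n.+1 * 'I_n.+1 * 'I_n.+1 :=
  (inord (tnth t ord0).+1, inord ((tnth t (inord 1)).+1 + d),
   inord ((tnth t (inord 2)).+2 + d.*2)).
have lt_t (t : 3.-tuple 'I_m.+1) i : tnth t i <= m by rewrite -ltnS.
have FE t : [/\ (F t).1.1 = (tnth t ord0).+1 :> nat,
                (F t).1.2 = (tnth t (inord 1)).+1 + d :> nat
              & (F t).2 = (tnth t (inord 2)).+2 + d.*2 :> nat].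
  by split; rewrite inordK //; have := lt_t t ord0; have := lt_t t (inord 1);
     have := lt_t t (inord 2); lia.
have Finj : injective F.
  move=> t t' E; have [a b c] := FE t; have [a' b' c'] := FE t'.
  move: a b c; rewrite E a' b' c' => a b c; apply: eq_from_tnth => i.
  have [->|[->|->]] : i = ord0 \/ i = inord 1 \/ i = inord 2.
    case: i => [[|[|[|i]]] lt_i] //; [left | right; left | right; right];
    by apply: val_inj; rewrite /= ?inordK.
  - by apply: val_inj => /=; lia.
  - by apply: val_inj => /=; lia.
  - by apply: val_inj => /=; lia.
have sub : F @: st \subset far_triples n d.
  apply/subsetP=> _ /imsetP [t + ->]; rewrite !inE.
  have [-> -> ->] := FE t; rewrite !(tnth_nth ord0) /= !inordK //.
  case: t => [[|x [|y [|z [|? ?]]]] st_t] //=; lia.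
have := subset_leq_card sub; rewrite card_imset // /st card_sorted_tuples.
move=> le_c; apply: leq_trans (leq_mul (leqnn 6) le_c).
have -> : 6 = 3`! by [].
rewrite mulnC bin_ffact (_ : 3 + m = m.+3) ; last by lia.
by rewrite !ffactnS ffactn0 /=; nia.
Qed.
End Counting.

(** * Leaves handled per phase, and their total number *)

Section Cyk.
Local Open Scope nat_scope.
Variables (G : cfg) (n : nat) (S : cyk_trees G n).
Local Notation D := (cyk_cdag S).
Local Notation root A i j := (cyk_root A i j : vtx D).

(* Besides the tree of the grammar root of [r], this comprises the vertices of
   the tree above it that have no other rule below them. *)
Definition owned (r : var G * (var G * var G)) i j (u : vtx D) : bool :=
  [&& u.1.1.2 == i, u.1.2 == j, labels S u != [::]
    & all (fun x => x.1 == r) (labels S u)].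

(** Reading only the first label gives each vertex at most one slot, so slots are no more numerous
    than vertices. On an owned vertex all labels carry the same rule. *)
Definition slot (u : vtx D) : option (var G * (var G * var G) * nat * nat) :=
  omap (fun x => (x.1, u.1.1.2, u.1.2)) (ohead (labels S u)).

Lemma owned_slot r i j u : owned r i j u -> slot u = Some (r, i, j).
Proof.
case/and4P=> /eqP <- /eqP <-; rewrite /slot.
by case: labels => [|x s] //= _ /andP [/eqP <-].
Qed.

Section Game.
Variables (M : nat) (segs : seq (seq (move D))).
Hypothesis segs_play : play M fset0 (@is_input D) (flatten segs).
Hypothesis segs_eval : forall v : vtx D, is_vtx v ->
  v \in loads (flatten segs) ++ calcs (flatten segs).

(** Inputs cannot be computed, so the [n] inputs of the start variable are all loaded. *)
Lemma game_inputs : n <= count (@is_transfer D) (flatten segs).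
Proof.
rewrite -size_loads_stores; apply: leq_trans (leq_addr _ _).
rewrite -{1}(size_iota 1 n) -(size_map (fun i => root (start G) i i)).
apply: uniq_leq_size.
  by rewrite map_inj_uniq ?iota_uniq // => i j [].
move=> _ /mapP [i + ->]; rewrite mem_iota => i1n.
have vi : is_vtx (root (start G) i i).
  by rewrite /=; lia.
have := segs_eval vi; rewrite mem_cat => /orP [//|].
move/(calcs_not_input segs_play); rewrite /is_input vi /=.
by rewrite ltnn.
Qed.

Hypothesis segs_io : all (fun ms => count (@is_transfer D) ms <= M.*2) segs.

Local Notation phs := (phases fset0 segs).

Let card0 : #|` fset0 : {fset vtx D}| <= M. Proof. by rewrite cardfs0. Qed.

Lemma phs_closed ph : ph \in phs -> phase_closed ph.
Proof.
apply: (phases_ind card0 segs_play segs_io).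
by move=> R bl ms _ pl _; apply: phase_of_closed pl.
Qed.

Lemma phs_sources ph : ph \in phs -> size (sources ph) <= 3 * M.
Proof.
apply: (phases_ind (P := fun ph => size (sources ph) <= 3 * M) card0 segs_play
  segs_io).
move=> R bl ms cR _ cm; apply: leq_trans (size_sources cR cm) _; lia.
Qed.

Lemma phs_sources_targets ph :
  ph \in phs -> size (sources ph ++ targets ph) <= 4 * M.
Proof.
apply: (phases_ind (P := fun ph => size (sources ph ++ targets ph) <= 4 * M)
  card0 segs_play segs_io).
move=> R bl ms cR pl cm; apply: leq_trans (size_sources_targets cR pl cm) _.
by lia.
Qed.

Lemma inner_le (ph : phase D) i j : inner ph i j <= size (sources ph).
Proof. exact: count_size. Qed.

(** Otherwise [root_touched] would give more than [3 * M] sources. *)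
Lemma far_root_source (ph : phase D) A i j :
  ph \in phs -> 0 < i -> i + 3 * M <= j -> j <= n ->
  root A i j \in touched ph -> (A, i, j) \in map fst (sources ph).
Proof.
move=> phP i0 ij jn /(root_touched (phs_closed phP)) [||//|[p ps]|]; try lia.
  by apply/mapP; exists (A, i, j, p).
by have := inner_le ph i j; have := phs_sources phP; lia.
Qed.

(** The isolation argument, with [U] the vertices owned by [r] at [(i, j)]: what an isolated phase
    computes there is never passed on. *)
Lemma rule_cover r i j k :
  r \in binary_rules G -> 0 < i -> i + 3 * M < j -> j <= n -> i <= k < j ->
  exists2 ph, ph \in phs &
    [/\ Some (r, i, j) \in map slot (sources ph ++ targets ph),
        root r.2.1 i k \in touched ph & root r.2.2 k.+1 j \in touched ph].
Proof.
move=> rb i0 ij jn kij; have lt_ij : i < j by lia.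
have [p vp Lp] := labels_grammar_root S i0 lt_ij jn rb.
have Lk x : (r, x) \in labels S (r.1, i, j, p) = (i <= x < j).
  rewrite Lp mem_map ?mem_index_iota //; by move=> ? ? [].
have op q : labels S (r.1, i, j, p ++ q) != [::] ->
    owned r i j (r.1, i, j, p ++ q).
  rewrite /owned /= !eqxx => -> /=; apply/allP=> x /labels_subtree.
  by rewrite Lp => /mapP [y _ ->] /=.
pose done k := exists2 ph, ph \in phs &
  [/\ ~~ isolated (owned r i j) ph, root r.2.1 i k \in touched ph
    & root r.2.2 k.+1 j \in touched ph].
suff [ph phP [niso X Y]] : done k.
  exists ph => //; split=> //; move: niso; rewrite negbK => /hasP [u us].
  by move=> /owned_slot <-; apply: map_f.
have [ph phP gp] := touched_phases fset0 (segs_eval vp).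
(* An isolated phase would build the whole tree of [r] with no source in it, which takes more than
   [3 * M] sources. *)
have [iso|niso] := boolP (isolated (owned r i j) ph).
  have H x : i <= x < j ->
    root r.2.1 i x \in touched ph /\ root r.2.2 x.+1 j \in touched ph.
    move=> xij; apply: (labels_touched (phs_closed phP) gp); last by rewrite Lk.
    move=> q /op oq; apply: contraL iso => qs; rewrite negbK.
    by apply/hasP; exists (r.1, i, j, p ++ q); rewrite // mem_cat qs.
  have : j - i < inner ph i j.
    apply: (inner_split (phs_closed phP) (X := r.2.1) (Y := r.2.2)) => //.
    - by case: (H i) => //; lia.
    - by move=> [|x] xij //; case: (H x) => //; lia.
    - by move=> x xij; apply: (root_touched (phs_closed phP)); lia.
  by have := inner_le ph i j; have := phs_sources phP; lia.
pose fine (u : vtx D) := forall x, (r, x) \in labels S u -> done x.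
suff : fine (r.1, i, j, p) by apply; rewrite Lk.
have og : owned r i j (r.1, i, j, p).
  have := op [::]; rewrite cats0; apply.
  by apply/eqP=> E; have := Lk k; rewrite E kij.
apply: (fine_touched segs_play _ _ phP niso gp og) => [u|ph' ph'P niso' u].
  (* The initial state is settled: an owned vertex has predecessors, so it is no input. *)
  case/and4P=> _ _ /preds_neq0 np _ [|/andP [_ /nilP]] //.
case/and4P=> /eqP ui /eqP uj _ /allP ur _ Hp x rx.
have [|[v [vp' Ev rv sv]]] := labels_preds rx.
  rewrite ui uj => -[/Hp [X _] /Hp [Y _]].
  by exists ph'.
have [_ fv] := Hp _ vp'; apply: (fv _ x rv).
rewrite /owned Ev ui uj !eqxx /=; apply/andP; split; last first.
  by apply/allP=> y /sv /ur.
by apply/eqP=> E; rewrite E in rv.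
Qed.
(** Leaves [(r, (i, k, j))] described by three projections (left factor, right factor, slot), each
    ranging over a list of length at most [3 * M], [3 * M] and [4 * M] respectively. *)
Definition incidences (ph : phase D) :
    {set (var G * (var G * var G)) * ('I_n.+1 * 'I_n.+1 * 'I_n.+1)} :=
  [set x : (var G * (var G * var G)) * ('I_n.+1 * 'I_n.+1 * 'I_n.+1) |
   [&& x.1 \in binary_rules G,
       (x.1.2.1, x.2.1.1 : nat, x.2.1.2 : nat) \in map fst (sources ph),
       (x.1.2.2, x.2.1.2.+1, x.2.2 : nat) \in map fst (sources ph)
     & Some (x.1, x.2.1.1 : nat, x.2.2 : nat)
         \in map slot (sources ph ++ targets ph)]].

Lemma distinct_binary_rules :
  distinct_rhs G -> {in binary_rules G &, injective snd}.
Proof.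
move=> hrhs [A [X Y]] [A' [X' Y']]; rewrite !inE /= => r1 r2 [EX EY].
by have [-> -> ->] : (A, (X, Y)) = (A', (X', Y')); first
  by have := hrhs _ _ r1 r2; rewrite /= EX EY => /(_ erefl) [->].
Qed.

Lemma card_incidences ph :
  distinct_rhs G -> ph \in phs -> #|incidences ph| ^ 2 <= 36 * M ^ 3.
Proof.
move=> hrhs phP; have sP := phs_sources phP.
have := phs_sources_targets phP.
rewrite -(size_map slot) => sQ; rewrite -(size_map fst) in sP.
apply: (@leq_trans ((3 * M) * (3 * M) * (4 * M))); last by nia.
apply: leq_trans (leq_mul (leq_mul sP sP) sQ).
pose f (x : (var G * (var G * var G)) * ('I_n.+1 * 'I_n.+1 * 'I_n.+1)) :=
  (x.1.2.1, x.2.1.1 : nat, x.2.1.2 : nat).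
pose g (x : (var G * (var G * var G)) * ('I_n.+1 * 'I_n.+1 * 'I_n.+1)) :=
  (x.1.2.2, x.2.1.2.+1, x.2.2 : nat).
pose h (x : (var G * (var G * var G)) * ('I_n.+1 * 'I_n.+1 * 'I_n.+1)) :=
  Some (x.1, x.2.1.1 : nat, x.2.2 : nat).
apply: (@card_le_projections _ _ _ _ f g h (incidences ph)).
  by move=> x; rewrite inE => /and4P [].
move=> [r1 [[i1 k1] j1]] [r2 [[i2 k2] j2]] x1 x2.
move=> [r3 [[i3 k3] j3]] [r4 [[i4 k4] j4]] x3 x4 /=.
move=> [E1 E2 E3] [E4 E5 E6] [E7 E8 E9] [E10 E11 E12].
(* The left projections give the first symbol, the right ones the second; distinct right-hand sides
   then identify the rule. *)
have Er : r1 = r3.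
  apply: (distinct_binary_rules hrhs).
  - by move: x1; rewrite inE => /and4P [].
  - by move: x3; rewrite inE => /and4P [].
  - by rewrite [LHS]surjective_pairing [RHS]surjective_pairing E7 E1 E10 -E4.
have -> : r2 = r4 by rewrite -E1 -E4.
rewrite Er; do !congr pair; apply: ord_inj; lia.
Qed.

Lemma game_incidences :
  distinct_rhs G ->
  exists cs : seq nat,
    [/\ size cs = size segs, all (fun c => c ^ 2 <= 36 * M ^ 3) cs
      & Gamma G * (n - 6 * M - 1) ^ 3 <= 6 * sumn cs].
Proof.
move=> hrhs; exists [seq #|incidences ph| | ph <- phs].
split; first by rewrite size_map size_phases.
  by apply/allP=> _ /mapP [ph phP ->]; apply: card_incidences.
rewrite sumnE big_map.
have -> : Gamma G = #|binary_rules G|.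
  exact/card_in_imset/distinct_binary_rules.
have := card_far_triples n (3 * M); rewrite (_ : (3 * M).*2 = 6 * M); last lia.
move/(leq_mul (leqnn #|binary_rules G|))/leq_trans; apply.
(* With gap [3 * M], [rule_cover] yields a phase for each leaf, and [far_root_source] puts a source
   in the trees of both factors. *)
rewrite mulnCA leq_mul2l /= -cardsX; apply: card_cover_le => -[r [[i k] j]].
rewrite !inE /= => /andP [rb /and3P [i0 ik kj]].
have {}rb : r \in binary_rules G by rewrite inE.
have := ltn_ord j; have := ltn_ord k; rewrite !ltnS => kn jn.
have [|||ph phP [Q X Y]] := @rule_cover r i j k rb i0; try lia.
exists ph; rewrite // inE rb Q andbT /=.
by rewrite !far_root_source //; lia.
Qed.

End Game.

(** The predecessor in [(size cs).-1] discounts the first phase, which may move fewer than [2M]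
    words. *)
Lemma schedule_words M B (s : state D) ops :
  0 < M -> distinct_rhs G -> schedule M B s ops ->
  n <= B * io_count ops /\
  exists cs : seq nat,
    [/\ M.*2 * (size cs).-1 <= B * io_count ops,
        all (fun c => c ^ 2 <= 36 * M ^ 3) cs
      & Gamma G * (n - 6 * M - 1) ^ 3 <= 6 * sumn cs].
Proof.
move=> M0 hrhs [[s0 s_in _] lg ev].
have M2 : 0 < M.*2 by rewrite double_gt0.
have [ms0 [segs [Ems io_segs lt_io]]] :=
  split_phases (@is_transfer D) (moves s ops) M2.
have pl : play M fset0 (@is_input D) (flatten (ms0 :: segs)).
  by rewrite Ems -s0; apply: play_moves lg.
have ev' v : is_vtx v ->
    v \in loads (flatten (ms0 :: segs)) ++ calcs (flatten (ms0 :: segs)).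
  by move=> /ev [t /cache_moves]; rewrite s0 in_fset0 Ems mem_cat.
have le_io := count_moves lg; split.
  by have := game_inputs pl ev'; rewrite Ems => /leq_trans; apply.
have [cs [Ecs cs_le Gcs]] := game_incidences pl ev' io_segs hrhs.
exists cs; split=> //; rewrite Ecs /=.
by apply: leq_trans le_io; apply: leq_trans lt_io; apply: leq_addr.
Qed.

End Cyk.

(** * Real arithmetic leading to the stated bound *)

Theorem theorem12 (R : rcfType) (a b n M B : nat)
    (ha : (3 <= a)%N) (hb : (3 <= b)%N)
    (hn : n = (2 ^ a)%N) (hM : M = (2 ^ b)%N) (hB : (0 < B)%N)
    (G : cfg) (hcnf : chomsky_normal_form G) (hrhs : distinct_rhs G)
    (w : n.-tuple (term G)) (S : cyk_trees G n)
    (s : state (cyk_cdag S)) (ops : seq (op (cyk_cdag S)))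
    (hops : schedule M B s ops) :
  Num.max
    ((n%:R - 6 * M%:R - 1) ^+ 3 / (18 * Num.sqrt M%:R) * (Gamma G)%:R
       - 2 * M%:R * (Gamma G)%:R)
    n%:R
  * (1 / B%:R)
  <= (io_count ops)%:R :> R.
Proof.
have M0 : (0 < M)%N by rewrite hM expn_gt0.
have [n_io [cs [cs_io cs_le Gcs]]] := schedule_words M0 hrhs hops.
have B0 : 0 < B%:R :> R by rewrite ltr0n.
rewrite mul1r ler_pdivrMr //.
have -> : (io_count ops)%:R * B%:R = (B * io_count ops)%:R :> R.
  by rewrite mulrC natrM.
move: (B * io_count ops)%N n_io cs_io => W n_io cs_io.
rewrite ge_max ler_nat n_io andbT.
(* Here the cube is negative and the bound trivial; beyond, truncated and real subtraction agree. *)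
have [n_le|n_gt] := leqP n (6 * M).
  have le0 : (n%:R - 6 * M%:R - 1) ^+ 3 / (18 * Num.sqrt M%:R) <= 0 :> R.
    rewrite pmulr_lle0 ?invr_gt0 ?mulr_gt0 ?sqrtr_gt0 ?ltr0n // exprS.
    rewrite mulr_le0_ge0 ?sqr_ge0 //.
    by rewrite -addrA -opprD subr_le0 -natrM natr1 ler_nat; lia.
  apply: (@le_trans _ _ 0); rewrite ?ler0n // subr_le0.
  by rewrite (le_trans (mulr_le0_ge0 le0 (ler0n _ _))) ?mulr_ge0 ?ler0n.
have -> : n%:R - 6 * M%:R - 1 = (n - 6 * M - 1)%:R :> R.
  have {1}-> : n = (n - 6 * M - 1 + 6 * M + 1)%N by lia.
  by rewrite 2!natrD natrM; ring.
set m := (n - 6 * M - 1)%N in Gcs *; set q : R := Num.sqrt M%:R.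
have q0 : 0 < q by rewrite sqrtr_gt0 ltr0n.
have qq : q ^+ 2 = M%:R by rewrite sqr_sqrtr ?ler0n.
have [G0|G0] := posnP (Gamma G).
  by rewrite G0 !mulr0 subr0 ler0n.
(* Each phase contributes at most [6 * q ^+ 3], the square root of [36 * M ^ 3]. *)
have cs_sum : (sumn cs)%:R <= (size cs)%:R * (6 * q ^+ 3) :> R.
  elim: cs cs_le {cs_io Gcs} => [|c cs IH] /=; first by rewrite mul0r.
  case/andP=> c_le /IH {}IH; rewrite natrD -natr1 mulrDl mul1r addrC lerD //.
  rewrite -(@ler_pXn2r _ 2) ?nnegrE ?ler0n ?mulr_ge0 ?exprn_ge0 ?(ltW q0) //.
  have -> : (6 * q ^+ 3) ^+ 2 = (36 * M ^ 3)%:R.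
    by rewrite natrM natrX -qq exprMn -!exprM -natrX.
  by rewrite -natrX ler_nat.
have le1 : (Gamma G)%:R * m%:R ^+ 3 <= 36 * (size cs)%:R * q ^+ 3.
  apply: (@le_trans _ _ (6 * (sumn cs)%:R)).
    by rewrite -natrX -!natrM ler_nat.
  rewrite (_ : 36 * _ * _ = 6 * ((size cs)%:R * (6 * q ^+ 3))) ?ler_pM2l //.
  by ring.
rewrite lerBlDr.
have -> : m%:R ^+ 3 / (18 * q) * (Gamma G)%:R =
          (Gamma G)%:R * m%:R ^+ 3 / (18 * q).
  by rewrite mulrAC [m%:R ^+ 3 * _]mulrC.
rewrite ler_pdivrMr ?mulr_gt0 //; apply: le_trans le1 _.
rewrite (_ : 36 * _ * _ = (2 * M%:R * (size cs)%:R) * (18 * q)); last first.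
  by rewrite -qq; ring.
rewrite ler_pM2r ?mulr_gt0 // -!natrM -natrD ler_nat.
(* The discounted phase costs [2 * M], at most [2 * M * Gamma G] since [Gamma G] is positive. *)
by case: (size cs) cs_io => [|k] /=; nia.
Qed.
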